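(* Let $G$ be a finite solvable SST-group with nilpotent residual $L$, and let $D$ be a system normalizer of $G$. Then the Frattini subgroup of $G$ satisfies $\Phi(G)=\Phi(L)\times\Phi(D)$. Furthermore, $G/\Phi(G)$ is a complemented group.
   Context: All groups are finite. Two subgroups $A,B$ of a group permute if $AB=BA$. A supplement of $H$ in $G$ is a subgroup $K\le G$ with $G=HK$. A subgroup $H$ of a group $G$ is SS-permutable in $G$ if $H$ has a supplement $K$ in $G$ such that $H$ permutes with every Sylow subgroup of $K$ (for all primes). $G$ is an SST-group if SS-permutability is transitive: whenever $H\le K\le G$, $H$ is SS-permutable in $K$ and $K$ is SS-permutable in $G$, then $H$ is SS-permutable in $G$. The nilpotent residual of $G$ is the intersection of all normal subgroups $N$ of $G$ such that $G/N$ is nilpotent. For a solvable group $G$ with set of prime divisors of $|G|$ equal to $\{p_1,\dots,p_k\}$, a Sylow system is a set $\{Q_1,\dots,Q_k\}$ where $Q_i$ is a Hall $p_i'$-subgroup of $G$, and the corresponding system normalizer is $\bigcap_{i=1}^k N_G(Q_i)$. A group is complemented if every subgroup $H$ has a complement, i.e. a subgroup $C$ with $G=HC$ and $H\cap C=1$. $\Phi(X)$ denotes the Frattini subgroup of $X$; the equality $\Phi(G)=\Phi(L)\times\Phi(D)$ is as an internal direct product. *)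

(* Defs.v *)
From mathcomp Require Import all_boot all_fingroup all_solvable.

Set Implicit Arguments.
Unset Strict Implicit.
Unset Printing Implicit Defensive.

Local Open Scope group_scope.

Definition ss_permutable (gT : finGroupType) (H G : {group gT}) : Prop :=
  H \subset G /\
  exists K : {group gT},
    [/\ K \subset G,
        H * K = G
      & forall (p : nat) (P : {group gT}),
          prime p -> p.-Sylow(K) P -> commute (H : {set gT}) (P : {set gT})].

Definition sst_group (gT : finGroupType) (G : {group gT}) : Prop :=
  forall H K : {group gT},
    H \subset K -> K \subset G ->
    ss_permutable H K -> ss_permutable K G -> ss_permutable H G.

Definition nilpotent_residual (gT : finGroupType) (G : {group gT}) : {set gT} :=
  \bigcap_(N : {group gT} | (N <| G) && nilpotent (G / N)) N.

Canonical nilpotent_residual_group (gT : finGroupType) (G : {group gT}) :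
  {group gT} := Eval hnf in [group of nilpotent_residual G].

(* A Sylow system is indexed by the primes dividing #|G|; the values of Q
   elsewhere are irrelevant. *)
Definition sylow_system (gT : finGroupType) (G : {group gT})
    (Q : nat -> {group gT}) : Prop :=
  forall p : nat, p \in \pi(G) -> p^'.-Hall(G) (Q p).

(* The outer G only matters when G is trivial: the intersection is then empty,
   and \bigcap would return the whole type gT. *)
Definition system_normalizer (gT : finGroupType) (G D : {group gT}) : Prop :=
  exists Q : nat -> {group gT},
    sylow_system G Q /\
    D = G :&: \bigcap_(p <- primes #|G|) 'N_G(Q p) :> {set gT}.

Definition complemented_group (gT : finGroupType) (G : {group gT}) : Prop :=
  forall H : {group gT}, H \subset G -> [splits G, over H].

(* Main.v *)
Require Import Defs.
From mathcomp Require Import all_boot all_fingroup all_solvable.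

(** Let L be the nilpotent residual of the solvable SST-group G.

    A normal subgroup is SS-permutable, and so is every subgroup of a nilpotent
    group. Hence transitivity makes every subgroup H of 'O_p(G) SS-permutable
    in G; then H permutes with all Sylow q-subgroups of G for q <> p, and is
    therefore normalised by all p'-subgroups of G ([sst_pcore_norm]). On the
    other hand, a p'-element that normalises all subgroups of a p-group P and
    fixes a nontrivial element of P centralises P ([pgroup_power_fix]).

    SST passes to quotients, so first let 'O_p^'(G) = 1. Then 'O_p(G) contains
    its own centraliser, and for z <> 1 in 'O_p(G) central in a Sylow
    p-subgroup P, the cyclic group <[z]> is normal and 'C_G[z] = P: thus P is
    normal with abelian quotient ([sst_p'core1_Sylow]). Applied to G / 'O_p^'(G)
    for all p this shows that G^`(1), and so L, is nilpotent. If moreover p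
    divides #|L|, a p'-element acts on the image of P without fixed points, so
    that P lies in L ([residual_Sylow_sub]). So L is a normal nilpotent Hall
    subgroup, and by fixed-point-freeness again, together with an index count,
    a system normaliser D is a complement of L ([system_normalizer_compl]).

    D permutes with the Sylow subgroups of its supplement L, so D and all its
    subgroups are SS-permutable in G. Let H be a Sylow p-subgroup of 'Phi(D),
    and K a supplement of H as in the definition. As H consists of
    non-generators of D, L * K = G, so K contains Sylow p-subgroups of G; then
    H permutes with, and lies in, all of them. Thus H is contained in 'O_p(G),
    which centralises L. Consequently 'Phi(D) centralises L and is normal in G
    ([Phi_residual_compl_cent]), and N = 'Phi(L) * 'Phi(D) lies in 'Phi(G).

    Finally, in a nilpotent group X each subgroup containing 'Phi(X) is
    complemented modulo 'Phi(X) ([nilpotent_compl_mod_Phi]), and every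
    subgroup of L containing 'Phi(L) is normal in G. Gluing complements in L
    and in a conjugate of D shows that G / N is complemented. A complemented
    group has a trivial Frattini subgroup, so N = 'Phi(G). *)

Local Open Scope group_scope.

(** * SS-permutable subgroups *)

Section SSPermutable.

Set Implicit Arguments.
Unset Strict Implicit.
Unset Printing Implicit Defensive.

Variable gT : finGroupType.
Implicit Types G H K N P Q R S : {group gT}.
Implicit Types p q : nat.

Lemma normal_ss_permutable N G : N <| G -> ss_permutable N G.
Proof.
case/andP=> sNG nNG; split=> //; exists G; split=> //; first exact: mulSGid.
move=> p P _ sylP; apply/commute_sym/normC.
exact: subset_trans (pHall_sub sylP) nNG.
Qed.

Lemma nilpotent_ss_permutable H G :
  nilpotent G -> H \subset G -> ss_permutable H G.
Proof.
move=> nilG sHG; split=> //; exists G; split=> //; first exact: mulSGid.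
move=> p P _ sylP; apply: normC; apply: subset_trans sHG _.
by rewrite (nilpotent_Hall_pcore nilG sylP) gFnorm.
Qed.

Lemma quotient_ss_permutable N H G :
  N <| G -> ss_permutable H G -> ss_permutable (H / N)%G (G / N)%G.
Proof.
move=> /andP[sNG nNG] [sHG [K [sKG defG permH]]]; split; first exact: quotientS.
have nNH := subset_trans sHG nNG; have nNK := subset_trans sKG nNG.
exists (K / N)%G; split; [exact: quotientS | by rewrite -quotientMl // defG |].
move=> p P pr_p sylP; have [S sylS] := Sylow_exists p K.
have nNS := subset_trans (pHall_sub sylS) nNK.
have [_ /morphimP[x nNx Kx ->] ->] := Sylow_trans (quotient_pHall nNS sylS) sylP.
rewrite /commute /= -quotientJ // -!quotientMl //.
  by rewrite (permH p (S :^ x)%G) // pHallJ.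
by rewrite conj_subG // (subset_trans (pHall_sub sylS)).
Qed.

(** A supplement of [H / N] lifts to its full preimage, because [N] is contained
    in [H]. *)
Lemma ss_permutable_of_quotient N H G :
    N <| G -> N \subset H -> H \subset G ->
  ss_permutable (H / N)%G (G / N)%G -> ss_permutable H G.
Proof.
move=> nsNG sNH sHG [_ [Kb [sKG defG permH]]]; split=> //.
have [sNG nNG] := andP nsNG; have nNH := subset_trans sHG nNG.
have nsNH : N <| H by rewrite /normal sNH.
exists (coset N @*^-1 Kb)%G; split.
- by rewrite -(quotientGK nsNG) morphpreS.
- by rewrite -{1}(quotientGK nsNH) -cosetpreM defG /= quotientGK.
move=> p P pr_p sylP.
have sPK := pHall_sub sylP; have nNP : P \subset 'N(N).
  exact: subset_trans sPK (subsetIl _ _).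
have sylPb : p.-Sylow(Kb) (P / N)%G.
  by have := quotient_pHall nNP sylP; rewrite /= cosetpreK.
have := congr1 (fun A => coset N @*^-1 A) (permH p _ pr_p sylPb).
rewrite /= !cosetpreM quotientGK // (quotientK nNP) => eqHP.
rewrite /commute -{1}(mulGSid sNH) -mulgA eqHP -(normC nNP) -mulgA.
by rewrite (mulSGid sNH).
Qed.

Lemma quotient_sst N G : N <| G -> sst_group G -> sst_group (G / N)%G.
Proof.
move=> nsNG sstG Hb Kb sHKb sKGb permHK permKG.
pose H := (coset N @*^-1 Hb)%G; pose K := (coset N @*^-1 Kb)%G.
have defH : (H / N)%G = Hb by apply: val_inj; rewrite /= cosetpreK.
have defK : (K / N)%G = Kb by apply: val_inj; rewrite /= cosetpreK.
have sNH : N \subset H by rewrite sub_cosetpre.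
have sHK : H \subset K by apply: morphpreS.
have sKG : K \subset G by rewrite -(quotientGK nsNG) morphpreS.
have nsNK : N <| K by apply: normalS nsNG; rewrite ?(subset_trans sNH).
rewrite -defH; apply: quotient_ss_permutable => //; apply: (sstG H K) => //.
  by apply: (@ss_permutable_of_quotient N) => //; rewrite defH defK.
apply: (@ss_permutable_of_quotient N); rewrite ?(subset_trans sNH) //.
by rewrite defK.
Qed.

Lemma pHall_supplement (pi : nat_pred) H K G S :
    H * K = G -> pi^'.-group H -> pi.-Hall(K) S -> pi.-Hall(G) S.
Proof.
move=> defG pi'H hallS; have sKG : K \subset G by rewrite -defG mulG_subr.
rewrite pHallE (subset_trans (pHall_sub hallS)) //= (card_Hall hallS).
rewrite eqn_dvd partn_dvd ?cardSg //=.
have: #|G|`_pi %| (#|H| * #|K|)`_pi.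
  by rewrite partn_dvd ?muln_gt0 ?cardG_gt0 // mul_cardG defG dvdn_mulr.
by rewrite partnM ?cardG_gt0 // (part_p'nat pi'H) mul1n.
Qed.

(** Once [K] contains one Sylow p-subgroup [S] of [G], all Sylow p-subgroups of
    [G = K * H] are of the form [S :^ (k * h)]: [H] permutes with [S :^ k] by
    assumption, hence with its conjugate by [h]. *)
Lemma ss_permutable_commute_Sylow p H K G S P :
    K \subset G -> H * K = G ->
    (forall R, p.-Sylow(K) R -> commute (H : {set gT}) R) ->
    p.-Sylow(G) S -> S \subset K -> p.-Sylow(G) P ->
  commute (H : {set gT}) P.
Proof.
move=> sKG defG permH sylS sSK sylP.
have [x Gx ->] := Sylow_trans sylS sylP.
have: x \in K * H by rewrite -(comm_group_setP _) ?defG ?groupP.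
case/mulsgP=> k h Kk Hh ->{x Gx}.
have sylR : p.-Sylow(K) (S :^ k)%G by rewrite pHallJ // (pHall_subl sSK sKG).
have := congr1 (conjugate^~ h) (permH _ sylR).
by rewrite /= !conjsMg conjGid // -conjsgM.
Qed.

Lemma pgroup_ss_permutable_commute p q H G Q :
    p.-group H -> ss_permutable H G -> prime q -> q != p -> q.-Sylow(G) Q ->
  commute (H : {set gT}) Q.
Proof.
move=> pH [sHG [K [sKG defG permH]]] pr_q q'p sylQ.
have [S sylS] := Sylow_exists q K.
apply: (@ss_permutable_commute_Sylow q H K G S) => // [R sylR||].
- exact: permH sylR.
- apply: pHall_supplement defG _ sylS.
  by apply: sub_pgroup pH => r /eqnP->; rewrite !inE eq_sym.
exact: pHall_sub sylS.
Qed.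

End SSPermutable.

(** * Action of p'-elements on p-subgroups and the Fitting subgroup *)

Section SstPcore.

Set Implicit Arguments.
Unset Strict Implicit.
Unset Printing Implicit Defensive.

Variable gT : finGroupType.
Implicit Types G H K N P Q R S X : {group gT}.
Implicit Types p q : nat.
Implicit Types x z c : gT.

(** [H] is subnormal in [G], hence SS-permutable; it permutes with a Sylow
    q-subgroup [Q], and is the intersection of [H * Q] with ['O_p(G)]. *)
Lemma sst_pcore_norm p G H R :
    sst_group G -> H \subset 'O_p(G) -> R \subset G -> p^'.-group R ->
  R \subset 'N(H).
Proof.
move=> sstG sHF sRG p'R; have pH := pgroupS sHF (pcore_pgroup p G).
have nilF := pgroup_nil (pcore_pgroup p G).
have permHG : ss_permutable H G.
  apply: (sstG H 'O_p(G)%G) => //; first exact: pcore_sub.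
    exact: nilpotent_ss_permutable.
  exact/normal_ss_permutable/pcore_normal.
rewrite -(Sylow_gen R) gen_subG; apply/bigcupsP=> S /SylowP[q pr_q sylS].
have sSR := pHall_sub sylS; have qS := pHall_pgroup sylS.
have [-> | ntS] := eqsVneq S 1; first exact: sub1G.
have q'p : q != p.
  have [/= _ q_dv_S _] := pgroup_pdiv qS ntS.
  exact: pgroupP (pgroupS sSR p'R) _ pr_q q_dv_S.
have [Q sylQ sSQ] := Sylow_superset (subset_trans sSR sRG) qS.
apply: subset_trans sSQ _.
have permHQ := pgroup_ss_permutable_commute pH permHG pr_q q'p sylQ.
have tiFQ : Q :&: 'O_p(G) = 1.
  apply: coprime_TIg; apply: (p'nat_coprime _ (pcore_pgroup p G)).
  by apply: sub_pgroup (pHall_pgroup sylQ) => r /eqnP->; rewrite !inE.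
have <- : (H <*> Q) :&: 'O_p(G) = H.
  by rewrite comm_joingE // -group_modl // tiFQ mulg1.
apply: normsI; first by rewrite (subset_trans _ (normG _)) ?joing_subr.
by rewrite (subset_trans (pHall_sub sylQ)) // gFnorm.
Qed.

(** If [z] is not in [<[c]>], the commutator [[~ z, x] = [~ z * c, x]] lies in
    both [<[z]>] and [<[z * c]>], which are distinct of order [p]. *)
Lemma norm_cycles_fix x z c p :
    prime p -> #[z] = p -> #[c] = p -> commute z c -> x \in 'C[c] ->
    x \in 'N(<[z]>) -> x \in 'N(<[z * c]>) ->
  x \in 'C[z].
Proof.
move=> pr_p oz oc czc cxc nzx nzcx.
have [z_c | not_z_c] := boolP (z \in <[c]>).
  by case/cycleP: z_c => i ->; rewrite cent1C groupX // cent1C.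
have fix_c : [~ c, x] = 1 by apply/eqP/commgP/commute_sym/cent1P.
have eq_comm : [~ z * c, x] = [~ z, x].
  have -> : [~ z * c, x] = [~ c * z, x] by rewrite czc.
  by rewrite commMgJ fix_c conj1g mul1g.
have comm_cycle y : x \in 'N(<[y]>) -> [~ y, x] \in <[y]>.
  by move=> nyx; rewrite commgEl groupM ?groupV ?memJ_norm ?cycle_id.
have: [~ z, x] \in <[z]> :&: <[z * c]>.
  by rewrite inE -{2}eq_comm !comm_cycle.
rewrite prime_TIg -?orderE ?oz //; last first.
  rewrite cycle_subG; apply/negP=> zc_z; case/negP: not_z_c.
  suffices -> : <[c]> = <[z * c]> by [].
  apply/eqP; rewrite eqEcard cycle_subG -(groupMl _ zc_z) cycle_id /=.
  rewrite -!orderE oc dvdn_leq ?prime_gt0 // order_dvdn expgMn //.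
  by rewrite -{1}oz -oc !expg_order mulg1.
by move/set1P=> /eqP/commgP/commute_sym/cent1P.
Qed.

(** With [A = <[a]>], the subgroups ['C_A(<[x]>)] and [[~: A, <[x]>]] meet
    trivially by coprimeness; as [A] is a cyclic p-group, one of them is
    trivial. *)
Lemma cycle_coprime_fix p x a c :
    p.-elt a -> p^'.-elt x -> x \in 'N(<[a]>) ->
    c \in <[a]> -> c != 1 -> x \in 'C[c] ->
  x \in 'C[a].
Proof.
move=> pa p'x nax a_c nt_c cxc.
have nAX : <[x]> \subset 'N(<[a]>) by rewrite cycle_subG.
have coAX : coprime #|<[a]>| #|<[x]>| by rewrite -!orderE (pnat_coprime pa).
have tiAX := coprime_abel_cent_TI nAX coAX (cycle_abelian a).
have [AX1 | ntAX] := eqVneq [~: <[a]>, <[x]>] 1.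
  move/commG1P: AX1; rewrite centsC cycle_subG => /centP cax.
  by apply/cent1P/cax/cycle_id.
have sAX : [~: <[a]>, <[x]>] \subset <[a]> by rewrite commg_subl.
have [pr_p p_dv_AX _] := pgroup_pdiv (pgroupS sAX pa) ntAX.
have [d AXd od] := Cauchy pr_p p_dv_AX.
have sCA : <[c]> \subset <[a]> by rewrite cycle_subG.
have [|_ p_dv_c _] := pgroup_pdiv (pgroupS sCA pa); first by rewrite cycle_eq1.
have [b c_b ob] := Cauchy pr_p p_dv_c.
have cxb : b \in 'C(<[x]>).
  by case/cycleP: c_b => i ->; rewrite cent_cycle groupX // cent1C.
(* A cyclic group has at most one subgroup of order p. *)
have eq_bd : <[b]> = <[d]>.
  apply/eqP; rewrite (eq_subG_cyclic (cycle_cyclic a)) -?orderE ?ob ?od //.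
    by rewrite cycle_subG (subsetP sCA).
  by rewrite cycle_subG (subsetP sAX).
have /set1gP b1 : b \in [1 gT].
  rewrite -tiAX inE cxb andbT -cycle_subG eq_bd cycle_subG //.
by rewrite -ob b1 order1 in pr_p.
Qed.

(** A p'-element normalising every subgroup of a p-group and fixing one
    nontrivial element acts trivially: the fixed element first forces a
    central element of order [p] to be fixed, and this one then forces
    everything else. *)
Lemma pgroup_power_fix p P x c :
    p.-group P -> p^'.-elt x -> (forall H, H \subset P -> x \in 'N(H)) ->
    c \in P -> c != 1 -> x \in 'C[c] ->
  P \subset 'C[x].
Proof.
move=> pP p'x nPx Pc nt_c cxc.
have pelt_P a : a \in P -> p.-elt a by apply: mem_p_elt.
have nPXa a : a \in P -> x \in 'N(<[a]>) by move=> Pa; rewrite nPx ?cycle_subG.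
have ntP : P :!=: 1 by apply/trivgPn; exists c.
have [pr_p _ _] := pgroup_pdiv pP ntP.
(* A fixed element b of order p forces each element commuting with b to be
   fixed. *)
have fix_of_prime a b : a \in P -> b \in P -> commute a b -> #[b] = p ->
    x \in 'C[b] -> x \in 'C[a].
  move=> Pa Pb cab ob cxb; have [-> | nt_a] := eqVneq a 1; first by rewrite cent11T inE.
  have [|_ p_dv_a _] := pgroup_pdiv (pelt_P a Pa); first by rewrite cycle_eq1.
  have [z a_z oz] := Cauchy pr_p p_dv_a.
  have Pz : z \in P by apply: subsetP a_z; rewrite cycle_subG.
  apply: (cycle_coprime_fix (pelt_P a Pa) p'x (nPXa a Pa) a_z).
    by rewrite -order_gt1 oz prime_gt1.
  apply: norm_cycles_fix pr_p oz ob _ cxb (nPXa z Pz) (nPXa _ (groupM Pz Pb)).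
  case/cycleP: a_z => i ->; apply/commute_sym/commuteX/commute_sym/cab.
have [z ZPz oz] : {z | z \in 'Z(P) & #[z] = p}.
  apply: Cauchy pr_p _.
  have ntZ : 'Z(P) != 1 by apply: contraNneq ntP => /(trivg_center_pgroup pP)->.
  by have [] := pgroup_pdiv (pgroupS (center_sub P) pP) ntZ.
have [Pz cPz] := setIP ZPz.
have cxz : x \in 'C[z].
  have [|_ p_dv_c _] := pgroup_pdiv (pelt_P c Pc); first by rewrite cycle_eq1.
  have [b c_b ob] := Cauchy pr_p p_dv_c.
  have Pb : b \in P by apply: subsetP c_b; rewrite cycle_subG.
  apply: (fix_of_prime z b) => //; first by apply/(centP cPz).
  by case/cycleP: c_b => i ->; rewrite cent1C groupX // cent1C.
apply/subsetP=> a Pa; rewrite cent1C; apply: (fix_of_prime a z) => //.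
by apply/commute_sym/(centP cPz).
Qed.

(** Otherwise, the last term of the derived series of ['C_G('F(G))] that is not
    in ['F(G)] would be a normal nilpotent subgroup of class at most 2. *)
Lemma sol_cent_Fitting G : solvable G -> 'C_G('F(G)) \subset 'F(G).
Proof.
move=> solG; set C := 'C_G('F(G)).
have nsCG : C <| G.
  by rewrite /normal subsetIl normsI ?normG ?norms_cent ?gFnorm.
have [n Cn1] := derivedP C (solvableS (normal_sub nsCG) solG).
have: exists k, C^`(k) \subset 'F(G) by exists n; rewrite Cn1 sub1G.
case/ex_minnP=> -[//|k] sCkF minCk.
suffices /minCk : C^`(k) \subset 'F(G) by rewrite ltnn.
apply: Fitting_max; first exact: gFnormal_trans.
suffices: nil_class C^`(k) <= 2.
  by move=> cl2; apply: small_nil_class; apply: leq_trans cl2 _.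
rewrite nil_class2 subsetI der_sub centsC /= (subset_trans (der_sub k _)) //.
by rewrite (subset_trans (subsetIr _ _)) ?centS.
Qed.

End SstPcore.

(** * The nilpotent residual and the Sylow subgroups of a solvable SST-group *)

Section NilpotentResidual.

Set Implicit Arguments.
Unset Strict Implicit.
Unset Printing Implicit Defensive.

Variable gT : finGroupType.
Implicit Types G H K N P Q R S X : {group gT}.

Lemma nilpotent_quotientP G N :
    G \subset 'N(N) ->
  reflect (exists n, 'L_n.+1(G) \subset N) (nilpotent (G / N)).
Proof.
move=> nNG; have sub1 n : ('L_n.+1(G) \subset N) = ('L_n.+1(G / N) == 1).
  rewrite -morphim_lcn // -subG1 quotient_sub1 //.
  by rewrite (subset_trans (lcn_sub _ _)).
by apply: (iffP (lcnP _)) => -[n Ln]; exists n;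
  [rewrite sub1 Ln | apply/eqP; rewrite -sub1].
Qed.

(** The index [#|G|.+1] is uniform in [N], so one term of the lower central
    series lies in all the normal subgroups with a nilpotent quotient. *)
Lemma lcn_card_sub G N :
  G \subset 'N(N) -> nilpotent (G / N) -> 'L_#|G|.+1(G) \subset N.
Proof.
move=> nNG nilGN; rewrite -quotient_sub1 ?(subset_trans (lcn_sub _ _)) //.
rewrite quotientE morphim_lcn // subG1; apply/eqP/lcn_nil_classP => //.
rewrite nilpotent_class in nilGN.
exact: leq_trans (ltnW nilGN) (leq_quotient _ _).
Qed.

Lemma nilpotent_residual_sub G N :
  N <| G -> nilpotent (G / N) -> nilpotent_residual G \subset N.
Proof. by move=> nsNG nilGN; apply: bigcap_inf; rewrite nsNG. Qed.

Lemma nilpotent_residual_normal G : nilpotent_residual G <| G.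
Proof.
rewrite /normal nilpotent_residual_sub //; last first.
  by rewrite trivg_quotient nilpotent1.
by apply: norms_bigcap; apply/bigcapsP=> N /andP[/andP[]].
Qed.

Lemma quotient_nilpotent_residual_nil G : nilpotent (G / nilpotent_residual G).
Proof.
have /andP[_ nLG] := nilpotent_residual_normal G.
apply/nilpotent_quotientP => //; exists #|G|.
apply/bigcapsP=> N /andP[/andP[_ nNG]]; exact: lcn_card_sub.
Qed.

End NilpotentResidual.

Section ResidualSylow.

Set Implicit Arguments.
Unset Strict Implicit.
Unset Printing Implicit Defensive.

Variable p : nat.

(** The case of trivial p'-core. For a nontrivial [z] of ['O_p(G)] central in
    [P], the group <[z]> is normal in [G] and [P] is the centraliser of [z]. *)
Lemma sst_p'core1_Sylow (gT : finGroupType) (G P : {group gT}) :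
    solvable G -> sst_group G -> 'O_p^'(G) = 1 -> p.-Sylow(G) P ->
  [/\ P <| G, G^`(1) \subset P & 'C_G(P) \subset P].
Proof.
move=> solG sstG Op'1 sylP; have sPG := pHall_sub sylP.
have pP := pHall_pgroup sylP.
have defF : 'F(G) = 'O_p(G) := Fitting_eq_pcore Op'1.
have sFP : 'O_p(G) \subset P := pcore_sub_Hall sylP.
have [G1 | ntG] := eqVneq G 1%G.
  have P1 : P :=: 1 by apply/trivgP; rewrite -[1]/(gval 1%G) -G1.
  by rewrite G1 P1 normal1 der_sub subsetIl.
have ntF : 'O_p(G) != 1 by rewrite -defF trivg_Fitting.
have nsFP : 'O_p(G) <| P by rewrite (normalS sFP sPG) ?pcore_normal.
have [z /setIP[Fz /setIP[Pz cPz]] ntz] :=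
  trivgPn _ (meet_center_nil (pgroup_nil pP) nsFP ntF).
have [R hallR] := Hall_exists p^' solG.
have /complP[_ defG] : R \in [complements to P in G] by rewrite (compl_pHall R sylP).
have nZG : G \subset 'N(<[z]>).
  rewrite -defG mul_subG //.
    by rewrite cents_norm // cent_cycle sub_cent1.
  apply: sst_pcore_norm sstG _ (pHall_sub hallR) (pHall_pgroup hallR).
  by rewrite cycle_subG.
have nsCG : 'C_G[z] <| G.
  by rewrite /normal subsetIl normsI ?normG // -cent_cycle norms_cent.
have p'cent x : x \in G -> p^'.-elt x -> x \in 'C[z] -> 'O_p(G) \subset 'C[x].
  move=> Gx p'x cxz; apply: (pgroup_power_fix _ p'x _ Fz ntz cxz) => //.
    exact: pcore_pgroup.
  move=> H sHF; rewrite -cycle_subG.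
  by apply: sst_pcore_norm sstG sHF _ _; rewrite ?cycle_subG.
(* A p'-element of 'C_G[z] centralises 'F(G) = 'O_p(G), hence lies in it. *)
have pC : p.-group 'C_G[z].
  apply/pgroupP=> q pr_q /(Cauchy pr_q)[x /setIP[Gx czx] ox].
  rewrite inE; apply: contraT => p'q.
  have p'x : p^'.-elt x by rewrite /p_elt ox pnatE.
  have : x \in 'F(G).
    apply: (subsetP (sol_cent_Fitting solG)); rewrite inE Gx defF.
    by rewrite -sub_cent1 p'cent.
  rewrite defF => /(mem_p_elt (pcore_pgroup p G)); rewrite /p_elt ox pnatE //.
  by rewrite inE (negbTE p'q).
have sPC : P \subset 'C_G[z] by rewrite subsetI sPG sub_cent1.
have defP : 'C_G[z] = P := sub_pHall sylP pC sPC (subsetIl _ _).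
rewrite -{1 2}defP; split=> //.
  rewrite subsetI der_sub gen_subG; apply/subsetP=> _ /imset2P[x y Gx Gy ->].
  have /cycleP[i zx] : z ^ x^-1 \in <[z]>.
    by rewrite memJ_norm ?cycle_id ?groupV ?(subsetP nZG).
  have /cycleP[j zy] : z ^ y^-1 \in <[z]>.
    by rewrite memJ_norm ?cycle_id ?groupV ?(subsetP nZG).
  change ([~ x, y] \in 'C[z]); rewrite cent1C.
  apply/cent1P/commgP/conjg_fixP.
  have -> : [~ x, y] = x^-1 * y^-1 * (x * y) by rewrite commgEl conjgE !mulgA.
  (* Automorphisms of the cyclic group <[z]> commute. *)
  have -> : z ^ (x^-1 * y^-1 * (x * y)) = z ^ (y^-1 * x^-1 * (x * y)).
    rewrite 2!(conjgM z (_ * _)) !(conjgM z _^-1) zx zy !conjXg zx zy -!conjXg.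
    by rewrite -!expgnA mulnC.
  by rewrite -invgM mulVg conjg1.
have <- : 'O_p(G) = P.
  by apply/eqP; rewrite eqEsubset sFP pcore_max // -defP.
by rewrite -defF sol_cent_Fitting.
Qed.

Lemma sst_p'core1_cent (gT : finGroupType) (G P Q : {group gT}) :
    solvable G -> sst_group G -> 'O_p^'(G) = 1 ->
    p.-Sylow(G) P -> p^'.-Hall(G) Q -> Q :!=: 1 ->
  'C_P(Q) = 1.
Proof.
move=> solG sstG Op'1 sylP hallQ ntQ.
have [nsPG _ sCP] := sst_p'core1_Sylow solG sstG Op'1 sylP.
have [x Qx ntx] := trivgPn _ ntQ.
have Gx : x \in G := subsetP (pHall_sub hallQ) x Qx.
have p'x : p^'.-elt x := mem_p_elt (pHall_pgroup hallQ) Qx.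
have pP := pHall_pgroup sylP.
apply/trivgP/subsetP=> c /setIP[Pc cQc]; rewrite inE.
apply: contraR ntx => ntc.
have cPx : P \subset 'C[x].
  apply: (pgroup_power_fix pP p'x _ Pc ntc) => [H sHP|].
    have sHF : H \subset 'O_p(G) by apply: subset_trans sHP _; rewrite pcore_max.
    by rewrite -cycle_subG (sst_pcore_norm sstG sHF) ?cycle_subG.
  by apply/cent1P/commute_sym/(centP cQc).
have Px : x \in P by apply: (subsetP sCP); rewrite inE Gx -sub_cent1.
by rewrite -order_eq1 (pnat_1 (mem_p_elt pP Px) p'x).
Qed.

Variables (gT : finGroupType) (G : {group gT}).
Hypotheses (solG : solvable G) (sstG : sst_group G).
Implicit Types P Q : {group gT}.
Let L := nilpotent_residual G.

(** If [p] divides the order of [L], then [G / 'O_p^'(G)] is not a p-group, and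
    its Hall p'-subgroups act without fixed points on its Sylow p-subgroup. *)
Lemma residual_prime_quotient P Q :
    p \in \pi(L) -> p.-Sylow(G) P -> p^'.-Hall(G) Q ->
  let W := 'O_p^'(G) in
  [/\ p.-Sylow(G / W) (P / W), p^'.-Hall(G / W) (Q / W), P / W <| G / W
     & 'C_(P / W)(Q / W) = 1].
Proof.
move=> piLp sylP hallQ W; have nWG : G \subset 'N(W) by apply: gFnorm.
have nsWG : W <| G by apply: pcore_normal.
have nWP : P \subset 'N(W) by apply: subset_trans (pHall_sub sylP) nWG.
have nWQ : Q \subset 'N(W) by apply: subset_trans (pHall_sub hallQ) nWG.
have sylPb := quotient_pHall nWP sylP; have hallQb := quotient_pHall nWQ hallQ.
have solGb : solvable (G / W) := quotient_sol _ solG.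
have sstGb : sst_group (G / W)%G by apply: quotient_sst.
have Op'1 : 'O_p^'(G / W) = 1 := trivg_pcore_quotient _ _.
have [nsPb _ _] := sst_p'core1_Sylow solGb sstGb Op'1 sylPb.
split=> //; apply: (sst_p'core1_cent solGb sstGb Op'1 sylPb hallQb).
apply: contraL piLp => /eqP Qb1.
have pGb : p.-group (G / W).
  have := card_Hall hallQb; rewrite Qb1 cards1 => /esym/eqP.
  by rewrite partG_eq1 pgroupNK.
have sLW : L \subset W := nilpotent_residual_sub nsWG (pgroup_nil pGb).
apply/negP; rewrite mem_primes => /and3P[pr_p _ p_dv_L].
have := pgroupP (pgroupS sLW (pcore_pgroup p^' G)) p pr_p p_dv_L.
by rewrite !inE eqxx.
Qed.

(** Modulo ['O_p^'(G)], coprime action gives [P = [~: P, Q]] for a Hall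
    p'-subgroup [Q], and [[~: P, Q]] lies in [L] since [G / L] is nilpotent. *)
Lemma residual_Sylow_sub P : p \in \pi(L) -> p.-Sylow(G) P -> P \subset L.
Proof.
move=> piLp sylP; have [Q hallQ] := Hall_exists p^' solG.
have [] := residual_prime_quotient piLp sylP hallQ; set W := 'O_p^'(G).
move=> sylPb hallQb nsPb CPQ1.
have nsLG : L <| G := nilpotent_residual_normal G.
have nLG := normal_norm nsLG; have nsWG : W <| G by apply: pcore_normal.
have nWG := normal_norm nsWG; have nWP := subset_trans (pHall_sub sylP) nWG.
have pPb := pHall_pgroup sylPb; have nPQ : Q / W \subset 'N(P / W).
  exact: subset_trans (pHall_sub hallQb) (normal_norm nsPb).
have coPQ : coprime #|P / W| #|Q / W| := pnat_coprime pPb (pHall_pgroup hallQb).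
have nilGLb : nilpotent ((G / W) / (L / W)).
  apply/nilpotent_quotientP; first exact: quotient_norms.
  have [n sLn] := nilpotent_quotientP nLG (quotient_nilpotent_residual_nil G).
  exists n; rewrite -morphim_lcn //; exact: quotientS.
have sRL : [~: P / W, Q / W] \subset L / W.
  have nLPb : P / W \subset 'N(L / W).
    exact: subset_trans (pHall_sub sylPb) (quotient_norms _ nLG).
  have nLQb : Q / W \subset 'N(L / W).
    exact: subset_trans (pHall_sub hallQb) (quotient_norms _ nLG).
  rewrite -quotient_cents2 //.
  apply: sub_nilpotent_cent2 nilGLb _ _ _; first exact/quotientS/pHall_sub/hallQb.
    exact/quotientS/pHall_sub/sylPb.
  by rewrite coprime_sym coprime_morph.
have sPR : P / W \subset [~: P / W, Q / W].
  set R := [~: _, _]; have nRP : P / W \subset 'N(R) by apply: commg_norml.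
  have nRQ : Q / W \subset 'N(R) by apply: commg_normr.
  have sRP : R \subset P / W by rewrite commg_subl.
  have := coprime_quotient_cent sRP nRQ coPQ (pgroup_sol pPb).
  rewrite CPQ1 quotient1 => /esym CPQb1.
  rewrite -quotient_sub1 // -CPQb1 subsetI subxx /=.
  by rewrite quotient_cents2.
have tiPW : W :&: P = 1.
  by apply: coprime_TIg; rewrite (p'nat_coprime (pcore_pgroup _ _) (pHall_pgroup sylP)).
have oP : #|P / W| = #|P| by rewrite -(card_isog (quotient_isog nWP tiPW)).
have sylPL := Sylow_setI_normal nsLG sylP.
have pdvL : #|P| %| #|L|`_p.
  rewrite -(part_pnat_id (pHall_pgroup sylP)) partn_dvd ?cardG_gt0 //.
  by rewrite -oP (dvdn_trans (cardSg (subset_trans sPR sRL))) ?dvdn_quotient.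
have <- : L :&: P = P; last exact: subsetIl.
apply/eqP; rewrite eqEcard subsetIr (card_Hall sylPL).
by rewrite dvdn_leq // part_gt0.
Qed.

Lemma der1_quotient_p'core : p.-group (G^`(1) / 'O_p^'(G)).
Proof.
have [P sylP] := Sylow_exists p G; have nsWG := pcore_normal p^' G.
have nWP := subset_trans (pHall_sub sylP) (normal_norm nsWG).
have sylPb := quotient_pHall nWP sylP.
have sstGb : sst_group (G / 'O_p^'(G))%G by apply: quotient_sst.
have [_ sG'P _] :=
  sst_p'core1_Sylow (quotient_sol _ solG) sstGb (trivg_pcore_quotient _ _) sylPb.
rewrite quotient_der ?normal_norm //.
exact: pgroupS sG'P (pHall_pgroup sylPb).
Qed.

Lemma residual_cent_Hall P Q :
    p \in \pi(L) -> p.-Sylow(G) P -> p^'.-Hall(G) Q -> 'C_P(Q) = 1.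
Proof.
move=> piLp sylP hallQ.
have [_ _ _] := residual_prime_quotient piLp sylP hallQ; set W := 'O_p^'(G).
have nWG : G \subset 'N(W) by apply: gFnorm.
have nWP := subset_trans (pHall_sub sylP) nWG.
move=> CPQ1; apply/trivgP.
have tiPW : W :&: P = 1.
  by apply: coprime_TIg; rewrite (p'nat_coprime (pcore_pgroup _ _) (pHall_pgroup sylP)).
rewrite -tiPW subsetI subsetIl andbT -quotient_sub1; last by rewrite subIset ?nWP.
rewrite -CPQ1 subsetI quotientS ?subsetIl //.
by rewrite (subset_trans (quotientS _ (subsetIr _ _))) // quotient_cent.
Qed.

End ResidualSylow.

(** * System normalizers *)

Section SystemNormalizer.

Set Implicit Arguments.
Unset Strict Implicit.
Unset Printing Implicit Defensive.

Variables (gT : finGroupType) (G : {group gT}).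
Hypotheses (solG : solvable G) (sstG : sst_group G).
Implicit Types A D H P Q : {group gT}.
Let L := nilpotent_residual G.
Let nsLG : L <| G := nilpotent_residual_normal G.

(** [L] lies in the derived subgroup, which is nilpotent: the p'-cores of [G]
    intersect trivially and each gives a p-quotient of [G^`(1)]. *)
Lemma residual_nil : nilpotent L.
Proof.
have sLG' : L \subset G^`(1).
  apply: nilpotent_residual_sub; first exact: gFnormal.
  exact/abelian_nil/der_abelian.
apply: nilpotentS sLG' _; apply/lcnP; exists #|G^`(1)|; apply/eqP.
apply: contraT => /trivgPn[x Lx ntx]; rewrite -order_gt1 in ntx.
have Wx : x \in 'O_(pdiv #[x])^'(G).
  apply: subsetP Lx; apply: lcn_card_sub.
    exact: subset_trans (der_sub 1 G) (gFnorm _ _).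
  exact/pgroup_nil/der1_quotient_p'core.
have piXx : pdiv #[x] \in \pi(#[x]) by rewrite pi_pdiv.
have := pnatPpi (mem_p_elt (pcore_pgroup _ _) Wx) piXx.
by rewrite !inE eqxx.
Qed.

Lemma residual_Hall : \pi(L).-Hall(G) L.
Proof.
rewrite /pHall normal_sub // pgroup_pi /=; apply/pnatP=> // p pr_p p_dv_ix.
rewrite inE /=; apply/negP=> piLp; have [P sylP] := Sylow_exists p G.
have sPL := residual_Sylow_sub solG sstG piLp sylP.
have [_ _ p'ix] := and3P sylP.
have := pnatP _ (indexg_gt0 _ _) p'ix p pr_p.
rewrite !inE eqxx => /(_ _)/negP[] //.
exact: dvdn_trans p_dv_ix (indexgS _ sPL).
Qed.

Lemma residual_Sylow_normal p P : p \in \pi(L) -> p.-Sylow(G) P -> P <| G.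
Proof.
move=> piLp sylP; have sPL := residual_Sylow_sub solG sstG piLp sylP.
have sylPL := pHall_subl sPL (normal_sub nsLG) sylP.
by rewrite (nilpotent_Hall_pcore residual_nil sylPL) gFnormal_trans.
Qed.

Lemma residual_part_prod :
  (\prod_(p <- primes #|G|) #|L|`_p = #|L|)%N.
Proof.
have piLG : {subset \pi(L) <= \pi(G)} by apply/pi_of_dvd/cardG_gt0/cardSg/normal_sub.
rewrite -[RHS](part_pnat_id (sub_in_pnat (in1W piLG) (pnat_pi (cardG_gt0 _)))).
rewrite (widen_partn _ (subset_leq_card (normal_sub nsLG))).
rewrite -[RHS]big_filter; under eq_bigr => p _ do rewrite p_part.
apply/perm_big/uniq_perm; rewrite ?primes_uniq ?filter_uniq ?iota_uniq // => p.
rewrite mem_filter mem_index_iota /= ltnS; apply/idP/andP=> [piGp | [] //].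
split=> //; apply: dvdn_leq => //; move: piGp.
by rewrite mem_primes => /and3P[].
Qed.

Lemma index_setI_bigcap (s : seq nat) (F : nat -> {group gT}) :
  #|G : G :&: \bigcap_(p <- s) F p| <= (\prod_(p <- s) #|G : F p|)%N.
Proof.
elim: s => [|p s IHs]; first by rewrite !big_nil setIT indexgg.
rewrite !big_cons; set B := \bigcap_(j <- s) F j in IHs *.
have [K defK] : exists K : {group gT}, G :&: B = K.
  rewrite /B; elim: (s) => [|q r [K]]; first by exists G; rewrite big_nil setIT.
  by rewrite big_cons setICA => ->; exists (F q :&: K)%G.
have sKG : K \subset G by rewrite -defK subsetIl.
rewrite setICA defK -(Lagrange_index sKG (subsetIr (F p) K)) mulnC.
apply: leq_mul; last by rewrite -defK.
by rewrite /= setIC indexgI subset_leq_card // imsetS.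
Qed.

(** A p-element of [L :&: D] centralises the Hall p'-subgroup [Q p], so it is
    trivial. Conversely the normaliser of [Q p] has index at most the p-part of
    [#|L|], whence [#|G : D| <= #|L|]. *)
Lemma system_normalizer_compl D :
  system_normalizer G D -> D \in [complements to L in G].
Proof.
case=> Q [hallQ defD].
have sDG : D \subset G by rewrite defD subsetIl.
have sDN p : p \in \pi(G) -> D \subset 'N(Q p).
  move=> piGp; rewrite defD (big_rem p) //= setICA.
  by rewrite (subset_trans (subsetIl _ _)) ?subsetIr.
have tiLD : L :&: D = 1.
  apply/eqP; apply: contraT; rewrite -cardG_gt1 => /pdiv_prime.
  set p := pdiv _ => pr_p.
  have [c /setIP[Lc Dc] oc] := Cauchy pr_p (pdiv_dvd #|L :&: D|).
  have piLp : p \in \pi(L).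
    by rewrite mem_primes pr_p cardG_gt0 -oc order_dvdG.
  have Gc := subsetP sDG c Dc.
  have piGp : p \in \pi(G).
    by rewrite mem_primes pr_p cardG_gt0 -oc order_dvdG.
  have [P sylP] := Sylow_exists p G.
  have nsPG := residual_Sylow_normal piLp sylP.
  have Pc : c \in P by rewrite (mem_normal_Hall sylP) // /p_elt oc pnat_id.
  have sQG := pHall_sub (hallQ p piGp).
  have: c \in 'C_P(Q p).
    rewrite inE Pc -sub_cent1 -cent_cycle centsC; apply/commG1P/trivgP.
    have <- : P :&: Q p = 1.
      by apply: coprime_TIg; rewrite (pnat_coprime (pHall_pgroup sylP) (pHall_pgroup (hallQ p piGp))).
    rewrite subsetI (subset_trans (commSg _ _ : _ \subset [~: P, Q p])) ?cycle_subG //.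
      by rewrite commg_subr cycle_subG (subsetP (sDN p piGp)).
    by rewrite commg_subl (subset_trans sQG) ?normal_norm.
  rewrite (residual_cent_Hall solG sstG piLp sylP (hallQ p piGp)) => /set1P c1.
  by rewrite -oc c1 order1 in pr_p.
have leGD : #|G : D| <= #|L|.
  rewrite defD (leq_trans (index_setI_bigcap _ (fun p => 'N_G(Q p))%G)) //.
  rewrite -residual_part_prod big_seq [leqRHS]big_seq.
  apply: leq_prod => p piGp; have hallQp := hallQ p piGp.
  have [piLp | /negbTE piL'p] := boolP (p \in \pi(L)).
    have [P sylP] := Sylow_exists p G.
    have sPL := residual_Sylow_sub solG sstG piLp sylP.
    have sylPL := pHall_subl sPL (normal_sub nsLG) sylP.
    rewrite -(card_Hall sylPL) (card_Hall sylP).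
    have <- : #|G : Q p| = (#|G|`_p)%N.
      apply/eqP; rewrite -(eqn_pmul2l (cardG_gt0 (Q p))) Lagrange ?sub_Hall //.
        by rewrite (card_Hall hallQp) mulnC partnC.
      exact: pHall_sub hallQp.
    by rewrite dvdn_leq // indexgS // subsetI normG (pHall_sub hallQp).
  (* As p does not divide #|L|, L lies in Q p, and Q p / L is a Hall subgroup
     of the nilpotent group G / L, so Q p is normal. *)
  have sLQ : L \subset Q p.
    apply: subset_trans (pcore_sub_Hall hallQp); rewrite pcore_max //.
    by rewrite /pgroup p'natEpi ?cardG_gt0 // piL'p.
  suffices nQG : G \subset 'N(Q p).
    by rewrite /= (setIidPl nQG) indexgg part_gt0.
  have nsLQ : L <| Q p := normalS sLQ (pHall_sub hallQp) nsLG.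
  have nLQ := subset_trans (pHall_sub hallQp) (normal_norm nsLG).
  have hallQb := quotient_pHall nLQ hallQp.
  have nilGL := quotient_nilpotent_residual_nil G.
  rewrite normal_norm // -(quotientGK nsLG) -(quotientGK nsLQ) cosetpre_normal.
  by rewrite (nilpotent_Hall_pcore nilGL hallQb) pcore_normal.
apply/complP; split=> //; apply/eqP; rewrite eqEcard mul_subG ?(normal_sub nsLG) //=.
by rewrite TI_cardMg //= -(Lagrange sDG) mulnC leq_mul2r leGD orbT.
Qed.

End SystemNormalizer.

(** * Frattini subgroups of nilpotent groups *)

Section Frattini.

Set Implicit Arguments.
Unset Strict Implicit.
Unset Printing Implicit Defensive.

Variable gT : finGroupType.
Implicit Types G H K M N U X C : {group gT}.

(** If a maximal subgroup [M] of [G] does not contain [N], then [N * M = G], so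
    [N * (U :&: M) = U], which is impossible for non-generators of [U]. *)
Lemma Phi_sub_normal G N U :
  N <| G -> U \subset G -> N \subset 'Phi(U) -> N \subset 'Phi(G).
Proof.
move=> /andP[sNG nNG] sUG sNPhi; apply/bigcapsP=> M.
case/predU1P=> [-> // | maxM]; have [prMG maxMG] := maxgroupP maxM.
have sMG := proper_sub prMG; apply: contraT => not_sNM.
have defG : N <*> M = G.
  apply/eqP; rewrite eqEproper join_subG sNG sMG /=.
  apply: contra not_sNM => prNM.
  by rewrite -(maxMG _ prNM (joing_subr N M)) joing_subl.
have sNU := subset_trans sNPhi (Phi_sub U).
have defU : N * (U :&: M) = U.
  rewrite setIC group_modl // -norm_joinEr ?(subset_trans sMG) // defG.
  exact/setIidPr.
have /Phi_nongen : 'Phi(U) <*> (U :&: M) = U.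
  apply/eqP; rewrite eqEsubset join_subG Phi_sub subsetIl -{1}defU.
  by rewrite mul_subG ?joing_subr // (subset_trans sNPhi) ?joing_subl.
rewrite genGid => defUM; case/negP: not_sNM.
by rewrite (subset_trans sNU) // -defUM subsetIr.
Qed.

Lemma nilpotent_maximal_normal G M : nilpotent G -> maximal M G -> M <| G.
Proof.
move=> nilG /maxgroupP[prMG maxMG]; have sMG := proper_sub prMG.
rewrite /normal sMG; apply: contraT => not_nMG.
have prNG : 'N_G(M) \proper G by rewrite properE subsetIl subsetI subxx.
have := nilpotent_proper_norm nilG prMG.
by rewrite (maxMG _ prNG) ?properxx // subsetI sMG normG.
Qed.

Lemma nilpotent_der1_sub_Phi G : nilpotent G -> G^`(1) \subset 'Phi(G).
Proof.
move=> nilG; apply/bigcapsP=> M; case/predU1P => [-> | maxM].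
  exact: der_sub.
have nsMG := nilpotent_maximal_normal nilG maxM; apply: contraT => not_sG'M.
have defG := mulg_normal_maximal nsMG maxM (der_sub 1 G) not_sG'M.
have nMG := normal_norm nsMG.
have: (G / M)^`(1) \proper G / M.
  apply: (sol_der1_proper (quotient_sol M (nilpotent_sol nilG))) => //.
  rewrite -subG1 quotient_sub1 //; exact: (proper_subn (maxgroupp maxM)).
by rewrite -quotient_der // -{2}defG quotientMidl properxx.
Qed.

(** [C] is a minimal supplement of [H] among the subgroups containing
    ['Phi(G)]. A maximal subgroup [M] of [G] not containing [H :&: C] would be
    normal, and [C :&: M] would be a smaller supplement. *)
Lemma nilpotent_compl_mod_Phi G H :
    nilpotent G -> 'Phi(G) \subset H -> H \subset G ->
  exists C : {group gT},
    [/\ 'Phi(G) \subset C, C \subset G, H * C = G & H :&: C = 'Phi(G)].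
Proof.
move=> nilG sPhiH sHG.
pose suppl (C : {group gT}) := [&& 'Phi(G) \subset C, C \subset G & H * C == G].
have [|C minC _] := @mingroup_exists _ suppl G.
  by rewrite /suppl Phi_sub subxx mulSGid /=.
have [/and3P[sPhiC sCG /eqP defG] minimalC] := mingroupP minC.
exists C; split=> //; apply/eqP; rewrite eqEsubset subsetI sPhiH sPhiC !andbT.
apply/bigcapsP=> M; case/predU1P=> [-> | maxM]; first by rewrite subIset ?sHG.
have nsMG := nilpotent_maximal_normal nilG maxM; apply: contraT => not_sHCM.
have sHCG : H :&: C \subset G by rewrite subIset ?sHG.
have defHCM := mulg_normal_maximal nsMG maxM sHCG not_sHCM.
have sHCC : H :&: C \subset C := subsetIr H C.
have defC : (H :&: C) * (C :&: M) = C.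
  rewrite (setIC C M) group_modl // normC ?(subset_trans sHCG (normal_norm nsMG)) //.
  by rewrite defHCM; apply/setIidPr.
have eqC : (C :&: M)%G = C.
  apply/val_inj/minimalC; last exact: subsetIl.
  rewrite /suppl subsetI sPhiC Phi_sub_max //= subIset ?sCG //=.
  by rewrite -{1}(mulGSid (subsetIl H C)) -mulgA defC defG.
case/negP: not_sHCM; rewrite (subset_trans sHCC) //.
by rewrite -eqC subsetIr.
Qed.

Lemma complemented_Phi1 G : complemented_group G -> 'Phi(G) = 1.
Proof.
move=> complG; have /splitsP[C /complP[tiPhiC defG]] := complG 'Phi(G)%G (Phi_sub G).
have sCG : C \subset G by rewrite -defG mulG_subr.
have /Phi_nongen : 'Phi(G) <*> C = G.
  by rewrite norm_joinEr // (subset_trans sCG) ?gFnorm.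
rewrite genGid => defC; rewrite -tiPhiC defC; apply/esym/setIidPl/Phi_sub.
Qed.

End Frattini.

(** * Complements of the nilpotent residual *)

Section Complements.

Set Implicit Arguments.
Unset Strict Implicit.
Unset Printing Implicit Defensive.

Variables (gT : finGroupType) (G D : {group gT}).
Hypotheses (solG : solvable G) (sstG : sst_group G).
Let L := nilpotent_residual G.
Let nsLG : L <| G := nilpotent_residual_normal G.
Hypothesis complD : D \in [complements to L in G].
Implicit Types A H K P Q S : {group gT}.

Let sLG : L \subset G := normal_sub nsLG.
Let tiLD : L :&: D = 1. Proof. by case/complP: complD. Qed.
Let defG : L * D = G. Proof. by case/complP: complD. Qed.
Let sDG : D \subset G. Proof. by rewrite -defG mulG_subr. Qed.
Let nilL : nilpotent L := residual_nil solG sstG.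
Let hallL : \pi(L).-Hall(G) L := residual_Hall solG sstG.
Let hallD : \pi(L)^'.-Hall(G) D.
Proof. by rewrite -(compl_pHall D hallL). Qed.

Lemma residual_compl_nil : nilpotent D.
Proof.
have nLD := subset_trans sDG (normal_norm nsLG).
rewrite (isog_nil (quotient_isog nLD tiLD)) /= -quotientMidl defG.
exact: quotient_nilpotent_residual_nil.
Qed.

(** [D] is SS-permutable in [G] with supplement [L], whose Sylow subgroups are
    normal in [G]; transitivity then reaches all subgroups of [D]. *)
Lemma sub_residual_compl_ss_permutable H : H \subset D -> ss_permutable H G.
Proof.
move=> sHD; apply: (sstG sHD sDG).
  exact: nilpotent_ss_permutable residual_compl_nil sHD.
split=> //; exists (nilpotent_residual_group G); split=> //.
  by rewrite /= normC ?defG // (subset_trans sDG) ?normal_norm.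
move=> p P _ sylP; apply: normC; rewrite (nilpotent_Hall_pcore nilL sylP).
by rewrite (subset_trans sDG) ?normal_norm ?gFnormal_trans.
Qed.

Lemma Phi_residual_compl_cent : 'Phi(D) \subset 'C(L).
Proof.
rewrite -(Sylow_gen 'Phi(D)) gen_subG; apply/bigcupsP=> H /SylowP[p pr_p sylH].
have sHPhi := pHall_sub sylH; have sHD := subset_trans sHPhi (Phi_sub D).
have pH := pHall_pgroup sylH.
have [-> | ntH] := eqVneq H 1%G; first exact: sub1G.
have [_ p_dv_H _] := pgroup_pdiv pH ntH.
have p'L : p^'.-group L.
  have piL'p : p \in \pi(L)^' := pgroupP (pgroupS sHD (pHall_pgroup hallD)) _ pr_p p_dv_H.
  by rewrite /pgroup p'natEpi ?cardG_gt0.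
have [_ [K [sKG defHK permH]]] := sub_residual_compl_ss_permutable sHD.
(* D = H * (D :&: L * K), and H consists of non-generators of D. *)
have defLK : L * K = G.
  have sLKG : L <*> K \subset G by rewrite join_subG sLG.
  have defD : H * (D :&: L <*> K) = D.
    rewrite setIC group_modl // (_ : H * _ = G); first exact/setIidPr.
    apply/eqP; rewrite eqEsubset mul_subG ?(subset_trans sHD) //=.
    by rewrite -{1}defHK mulgS ?joing_subr.
  have /Phi_nongen: 'Phi(D) <*> (D :&: L <*> K) = D.
    apply/eqP; rewrite eqEsubset join_subG Phi_sub subsetIl -{1}defD.
    by rewrite mul_subG ?joing_subr // (subset_trans sHPhi) ?joing_subl.
  rewrite genGid -norm_joinEr ?(subset_trans sKG) ?normal_norm // => defDK.
  apply/eqP; rewrite eqEsubset sLKG -defG mul_subG ?joing_subl //.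
  by rewrite -defDK subsetIr.
have [S sylS] := Sylow_exists p K.
have sylSG := pHall_supplement defLK p'L sylS.
(* H permutes with every Sylow p-subgroup of G, and hence lies in it. *)
have sHF : H \subset 'O_p(G).
  apply/bigcapsP=> P maxP; have sylP : p.-Sylow(G) P by rewrite -max_pgroup_Sylow.
  apply: comm_sub_max_pgroup maxP pH (subset_trans sHD sDG) _.
  apply: ss_permutable_commute_Sylow sKG defHK _ sylSG (pHall_sub sylS) sylP.
  by move=> R sylR; apply: permH sylR.
apply: subset_trans sHF _; apply/commG1P/trivgP.
have <- : 'O_p(G) :&: L = 1.
  by apply: coprime_TIg; apply: pnat_coprime (pcore_pgroup _ _) p'L.
rewrite subsetI commg_subl commg_subr.
by rewrite (subset_trans sLG) ?gFnorm //= (subset_trans (pcore_sub _ _)) ?normal_norm.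
Qed.

Lemma Phi_residual_compl_normal : 'Phi(D) <| G.
Proof.
rewrite /normal (subset_trans (Phi_sub D)) // -defG mul_subG ?gFnorm //.
by rewrite cents_norm // centsC Phi_residual_compl_cent.
Qed.

(** [L] normalises [A] because [L^`(1)] lies in ['Phi(L)], and [D] normalises
    the Sylow subgroups of [A] by [sst_pcore_norm]. *)
Lemma sub_residual_normal A : 'Phi(L) \subset A -> A \subset L -> A <| G.
Proof.
move=> sPhiA sAL; rewrite /normal (subset_trans sAL) //= -defG mul_subG //.
  apply: sub_der1_norm => //; apply: subset_trans sPhiA.
  exact: nilpotent_der1_sub_Phi nilL.
rewrite -(Sylow_gen A); apply: (subset_trans _ (norm_gen _)).
apply/norms_bigcup/bigcapsP=> S /SylowP[p pr_p sylS].
have sSA := pHall_sub sylS; have pS := pHall_pgroup sylS.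
have [-> | ntS] := eqVneq S 1%G; first by rewrite norm1 subsetT.
have [_ p_dv_S _] := pgroup_pdiv pS ntS.
have piLp : p \in \pi(L).
  by rewrite mem_primes pr_p cardG_gt0 (dvdn_trans p_dv_S) // cardSg // (subset_trans sSA).
have sSF : S \subset 'O_p(G).
  have [P sylP sSP] := Sylow_superset (subset_trans sSA (subset_trans sAL sLG)) pS.
  by rewrite (normal_Hall_pcore sylP) ?(residual_Sylow_normal solG sstG piLp sylP).
apply: sst_pcore_norm sstG sSF sDG _.
by apply: sub_pgroup (pHall_pgroup hallD) => q; apply: contraNneq => ->.
Qed.

End Complements.

(** * The Frattini subgroup of a solvable SST-group *)

Section SstFrattini.

Set Implicit Arguments.
Unset Strict Implicit.
Unset Printing Implicit Defensive.

Variables (gT : finGroupType) (G D : {group gT}).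
Hypotheses (solG : solvable G) (sstG : sst_group G).
Let L := nilpotent_residual G.
Hypothesis complD : D \in [complements to L in G].
Implicit Types A B E H K N : {group gT}.

(** With [E] a Hall subgroup of [H] complementing [L :&: H], and [D1] a
    conjugate of [D] containing [E], a complement is [A * B], where [A]
    complements [L :&: H] in [L] and [B] complements [E] in [D1], both modulo
    Frattini subgroups. *)
Lemma compl_mod_Phi H :
    'Phi(L) * 'Phi(D) \subset H -> H \subset G ->
  exists K : {group gT},
    [/\ K \subset G, H * K = G & H :&: K = 'Phi(L) * 'Phi(D)].
Proof.
move=> sNH sHG; have nsLG : L <| G := nilpotent_residual_normal G.
have sLG : L \subset G := normal_sub nsLG.
have nilL : nilpotent L := residual_nil solG sstG.
have hallL : \pi(L).-Hall(G) L := residual_Hall solG sstG.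
have hallD : \pi(L)^'.-Hall(G) D by rewrite -(compl_pHall D hallL).
have [sPhiLH sPhiDH] : 'Phi(L) \subset H /\ 'Phi(D) \subset H.
  by split; apply: subset_trans sNH; rewrite (mulG_subl, mulG_subr).
have nsPhiD := Phi_residual_compl_normal solG sstG complD.
have hallHL := setI_normal_Hall nsLG hallL sHG.
have [E hallE] := Hall_exists \pi(L)^' (solvableS sHG solG).
have sEH := pHall_sub hallE; have pi'E := pHall_pgroup hallE.
have /complP[tiLE defH] : E \in [complements to L :&: H in H].
  by rewrite (compl_pHall E hallHL).
have sPhiE : 'Phi(D) \subset E.
  apply: subset_trans (pcore_sub_Hall hallE).
  rewrite pcore_max ?(pgroupS (Phi_sub D) (pHall_pgroup hallD)) //.
  exact: normalS sPhiDH sHG nsPhiD.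
have [D1 hallD1 sED1] := Hall_superset solG (subset_trans sEH sHG) pi'E.
have complD1 : D1 \in [complements to L in G] by rewrite (compl_pHall D1 hallL).
have [tiLD1 defG] := complP complD1; have sD1G := pHall_sub hallD1.
have nilD1 := residual_compl_nil complD1.
have eqPhi : 'Phi(D1) = 'Phi(D).
  have [g Gg ->] := Hall_trans solG hallD1 hallD.
  by rewrite /= PhiJ (normsP (normal_norm nsPhiD)).
have sPhiLLH : 'Phi(L) \subset L :&: H by rewrite subsetI Phi_sub.
have [A [sPhiA sAL defL meetA]] := nilpotent_compl_mod_Phi nilL sPhiLLH (subsetIl _ _).
rewrite -eqPhi in sPhiE sNH sPhiDH *.
have [B [sPhiB sBD defD1 meetB]] := nilpotent_compl_mod_Phi nilD1 sPhiE sED1.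
have nsAG := sub_residual_normal solG sstG complD1 sPhiA sAL.
have nAX (X : {group gT}) : X \subset G -> X \subset 'N(A).
  by move/subset_trans; apply; apply: normal_norm.
have sEG := subset_trans sEH sHG; have sBG := subset_trans sBD sD1G.
have defK : A <*> B = A * B by rewrite norm_joinEr ?nAX.
have defHK : H * (A <*> B) = G.
  by rewrite defK -defH -mulgA (mulgA E) (normC (nAX _ sEG)) -(mulgA A) defD1 mulgA defL.
have sKG : A <*> B \subset G by rewrite join_subG (normal_sub nsAG).
exists (A <*> B)%G; split=> //; apply/eqP; rewrite eq_sym eqEcard subsetI sNH /=.
rewrite {1}defK mulgSS //=.
have tiPhi : 'Phi(L) :&: 'Phi(D1) = 1.
  by apply/trivgP; rewrite -tiLD1 setISS ?Phi_sub.
have tiAB : A :&: B = 1 by apply/trivgP; rewrite -tiLD1 setISS.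
rewrite TI_cardMg //= -(leq_pmul2r (cardG_gt0 G)) -{1}defHK mulnC -mul_cardG.
(* The inclusion of the product in the intersection is clear, and the orders
   agree by counting. *)
have oL : (#|L :&: H| * #|A| = #|L| * #|'Phi(L)|)%N by rewrite mul_cardG /= defL meetA.
have oD : (#|E| * #|B| = #|D1| * #|'Phi(D1)|)%N by rewrite mul_cardG defD1 meetB.
rewrite /= defK (TI_cardMg tiAB) -{1}defH (TI_cardMg tiLE) mulnACA oL oD.
have oG : #|G| = (#|L| * #|D1|)%N by rewrite -defG (TI_cardMg tiLD1).
by rewrite oG mulnACA mulnC.
Qed.

Lemma Phi_mul_group : exists2 N : {group gT}, 'Phi(L) * 'Phi(D) = N & N <| G.
Proof.
have nsLG : L <| G := nilpotent_residual_normal G.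
have nsPhiL : 'Phi(L) <| G by apply: gFnormal_trans.
have nsPhiD := Phi_residual_compl_normal solG sstG complD.
exists ('Phi(L) <*> 'Phi(D))%G; last exact: normalY.
rewrite /= norm_joinEr // (subset_trans (normal_sub nsPhiD)) //.
exact: normal_norm.
Qed.

Lemma quotient_complemented N :
    'Phi(L) * 'Phi(D) = N -> N <| G -> complemented_group (G / N)%G.
Proof.
move=> defN nsNG Hb sHGb; have [sNG nNG] := andP nsNG.
pose H := (coset N @*^-1 Hb)%G.
have sNH : N \subset H := sub_cosetpre Hb.
have sHG : H \subset G by rewrite -(quotientGK nsNG) morphpreS.
have [|K [sKG defG meetHK]] := compl_mod_Phi _ sHG; first by rewrite defN.
have sNK : N \subset K by rewrite -defN -meetHK subsetIr.
have defHb : H / N = Hb by rewrite /= cosetpreK.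
apply/splitsP; exists (K / N)%G; apply/complP; rewrite -defHb; split.
  by rewrite -quotientIG // meetHK defN trivg_quotient.
by rewrite -quotientMl ?defG // (subset_trans sHG).
Qed.

Lemma sst_Phi : 'Phi(L) * 'Phi(D) = 'Phi(G).
Proof.
have [N defN nsNG] := Phi_mul_group.
have nsLG : L <| G := nilpotent_residual_normal G.
have sDG : D \subset G by have [_ <-] := complP complD; rewrite mulG_subr.
apply/eqP; rewrite eqEsubset mul_subG /=.
- have := quotient_complemented defN nsNG => /complemented_Phi1 Phi1.
  rewrite defN -quotient_sub1 ?(subset_trans (Phi_sub G)) ?normal_norm //.
  by rewrite -Phi1 morphimF ?normal_norm.
- apply: Phi_sub_normal (normal_sub nsLG) (subxx _); exact: gFnormal_trans.
apply: Phi_sub_normal sDG (subxx _).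
exact: Phi_residual_compl_normal solG sstG complD.
Qed.

End SstFrattini.

Theorem theorem1p12 (gT : finGroupType) (G D : {group gT})
    (solG : solvable G) (sstG : sst_group G) (snD : system_normalizer G D) :
  'Phi(nilpotent_residual G) \x 'Phi(D) = 'Phi(G) /\
  complemented_group (G / 'Phi(G))%G.
Proof.
have complD := system_normalizer_compl solG sstG snD.
have defPhi := sst_Phi solG sstG complD.
split; last exact: quotient_complemented defPhi (Phi_normal G).
have [tiLD _] := complP complD.
rewrite dprodE //.
  apply: subset_trans (Phi_residual_compl_cent solG sstG complD) _.
  exact/centS/Phi_sub.
by apply/trivgP; rewrite -tiLD setISS ?Phi_sub.
Qed.
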